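(* Consider the (transformed) Lorenz '63 system described in the context, observed through its first coordinate. For every $j\ge2$, for Lebesgue almost every initial point $u\in\mathcal B_R$, the following holds: $\|u\|<R$; the system of equations $HD^iu=HD^iv$ for every $0\le i\le j$ has the unique solution $v=u$ in $\mathcal B_R$; and $$\mathrm{span}\left\{\nabla\big((HD^iu)_l\big):0\le i\le j,\ 1\le l\le d_o\right\}=\mathbb R^3 .$$ As a consequence, for $\epsilon$-bounded observation errors ($\|Z_i\|\le\epsilon$ almost surely for every $i\in\mathbb N$), for almost every initial point $u\in\mathcal B_R$, for sufficiently small $h$ and every $k\ge2$, the diameters of the supports of the smoother $\mu^{\mathrm{sm}}(\cdot|Y_0,\ldots,Y_k)$ and the filter $\mu^{\mathrm{fi}}(\cdot|Y_0,\ldots,Y_k)$ are bounded by $C_{\mathrm{sm}}(u,k)\epsilon$ and $C_{\mathrm{fi}}(u,k)\epsilon$, respectively, for some finite constants $C_{\mathrm{sm}}(u,k)$ and $C_{\mathrm{fi}}(u,k)$ which do not depend on $\epsilon$. Moreover, for unbounded observation errors satisfying $\sigma_Z^2:=\mathbb E(\|Z_i\|^2)<\infty$, for almost every initial point $u\in\mathcal B_R$, for sufficiently small $h$ and every $k\ge2$, there are estimators based on the observations, $U_{\mathrm{sm}}(Y_0,\ldots,Y_k)$ and $U_{\mathrm{fi}}(Y_0,\ldots,Y_k)$, such that the mean square errors $\mathbb E\left[\|U_{\mathrm{sm}}(Y_0,\ldots,Y_k)-u\|^2\right]$ and $\mathbb E\left[\|U_{\mathrm{fi}}(Y_0,\ldots,Y_k)-u(t_k)\|^2\right]$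 of the initial and current positions are bounded by $D_{\mathrm{sm}}(u,k)\sigma_Z^2$ and $D_{\mathrm{fi}}(u,k)\sigma_Z^2$, respectively, for some finite constants $D_{\mathrm{sm}}(u,k)$ and $D_{\mathrm{fi}}(u,k)$ which do not depend on $\sigma_Z$.
   Context: System: $\frac{du}{dt}=-Au-B(u,u)+f$ on $\mathbb R^3$ with, for positive parameters $a,b,r$, $$A=\begin{pmatrix} a & -a & 0 \\ a & 1 & 0 \\ 0 & 0 & b \end{pmatrix},\quad B(u,\tilde u)=\begin{pmatrix} 0 \\ (u_1\tilde u_3+u_3\tilde u_1)/2 \\ -(u_1\tilde u_2+u_2\tilde u_1)/2 \end{pmatrix},\quad f=\begin{pmatrix} 0 \\ 0 \\ -b(r+a) \end{pmatrix}.$$ For $v\in\mathbb R^3$, $v(t)=\Psi_t(v)$ is the solution with $v(0)=v$, and $D^iv:=\frac{d^iv(t)}{dt^i}\big|_{t=0}$ (so $D^0v=v$). $R>0$ is such that, for some $\delta>0$, $\langle-Av-B(v,v)+f,v\rangle\le0$ whenever $\|v\|\in[R,R+\delta]$ (such $R$ exist); $\mathcal B_R=\{v:\|v\|\le R\}$, which is forward invariant; $\Psi_t$ is one-to-one from $\mathcal B_R$ onto $\Psi_t(\mathcal B_R)$ with inverse $\Psi_{-t}$. $\nabla$ denotes the gradient as a function of $u$, $(\cdot)_l$ the $l$th coordinate. Observations: $H=\mathrm{diag}(1,0,0)\in\mathbb R^{3\times3}$ ($d_o=3$), $t_i=ih$ with $h>0$, $Y_i=Hu(t_i)+Z_i$,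 $Z_i$ i.i.d. centered with density $\eta$, true initial point $u$; expectations are over the noise for fixed $u$. The prior $q$ is a probability density vanishing outside $\mathcal B_R$. Smoothing density: $\mu^{\mathrm{sm}}(v|Y_0,\ldots,Y_k)\propto q(v)\prod_{i=0}^k\eta(Y_i-H\Psi_{t_i}(v))$ for $v\in\mathcal B_R$, $0$ otherwise. Filtering density: $\mu^{\mathrm{fi}}(v|Y_0,\ldots,Y_k)\propto\left[\prod_{i=0}^k\eta(Y_i-H\Psi_{t_i-t_k}(v))\right]\det(J\Psi_{-t_k}(v))\,q(\Psi_{-t_k}(v))$ for $v\in\Psi_{t_k}(\mathcal B_R)$ ($J$ the Jacobian, $\Psi_{t_i-t_k}(v)=\Psi_{t_i}(\Psi_{-t_k}(v))$), $0$ otherwise. Support means the set where the density is nonzero; $\eta$ is taken to vanish outside $\{\|z\|\le\epsilon\}$ when the errors are $\epsilon$-bounded. *)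

(* Defs.v *)
From HB Require Import structures.
From mathcomp Require Import all_boot all_order all_algebra.
From mathcomp Require Import all_classical all_reals all_analysis.

Set Implicit Arguments.
Unset Strict Implicit.
Unset Printing Implicit Defensive.

Import Order.TTheory GRing.Theory Num.Theory.
Import numFieldNormedType.Exports.

Local Open Scope classical_set_scope.
Local Open Scope ring_scope.

(* The library norm on 'rV[R]_3 is the sup norm; the Euclidean one is
   [enorm]. *)
Definition dot (R : realType) (u v : 'rV[R]_3) : R :=
  \sum_(i < 3) u 0 i * v 0 i.

Definition enorm (R : realType) (v : 'rV[R]_3) : R := Num.sqrt (dot v v).

Definition cball (R : realType) (rad : R) : set 'rV[R]_3 :=
  [set v | enorm v <= rad].

(* -oo on the empty set, which is harmless for upper bounds. *)
Definition diameter (R : realType) (S : set 'rV[R]_3) : \bar R :=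
  ereal_sup [set (enorm (p.1 - p.2))%:E | p in S `*` S].

Definition supp (R : realType) (f : 'rV[R]_3 -> R) : set 'rV[R]_3 :=
  [set v | f v != 0].

(* Borel sigma-algebra of R^n, generated by the coordinates. *)
Section measurable_rV.
Context (R : realType) (n : nat).

Let coords : 'I_n -> 'rV[R]_n -> measurableTypeR R := fun i v => v 0 i.

Let rV_set0 : g_sigma_preimage coords set0.
Proof. exact: sigma_algebra0. Qed.

Let rV_setC A : g_sigma_preimage coords A -> g_sigma_preimage coords (~` A).
Proof. exact: sigma_algebraC. Qed.

Let rV_bigcup (F : _^nat) : (forall i, g_sigma_preimage coords (F i)) ->
  g_sigma_preimage coords (\bigcup_i (F i)).
Proof. exact: sigma_algebra_bigcup. Qed.

HB.instance Definition _ := @isMeasurable.Build default_measure_display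
  'rV[R]_n (g_sigma_preimage coords) rV_set0 rV_setC rV_bigcup.

Lemma measurable_fun_rVP d (T : measurableType d) (f : T -> 'rV[R]_n) :
  measurable_fun setT f <->
  forall i, measurable_fun setT (fun x => f x 0 i : measurableTypeR R).
Proof.
split=> [mf i|mf].
  move=> _ A mA; rewrite setTI.
  rewrite -[X in measurable X]setTI.
  apply: (mf measurableT [set v | A (v 0 i)]).
  apply: sub_sigma_algebra; rewrite -bigcup_seq /=.
  exists i => /=; first by rewrite mem_index_enum.
  by exists A => //; rewrite setTI.
move=> _ A mA; rewrite setTI.
pose G := [set B : set 'rV[R]_n | measurable (f @^-1` B)].
suff : @measurable _ 'rV[R]_n `<=` G by exact.
apply: smallest_sub.
  split.
  - by rewrite /G /= preimage_set0.
  - by move=> B GB; rewrite /G /= setTD preimage_setC; exact: measurableC.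
  - by move=> F GF; rewrite /G /= preimage_bigcup; exact: bigcupT_measurable.
rewrite -bigcup_seq => B [i _ [C mC <-]].
by rewrite /G /= setTI -[X in measurable X]setTI; exact: (mf i).
Qed.

End measurable_rV.

(* Lebesgue measure on R^3, carried over from the threefold product. *)
Section lebesgue3.
Context (R : realType).

Definition row3 (p : measurableTypeR R * measurableTypeR R * measurableTypeR R) :
  'rV[R]_3 := \row_(i < 3) [:: p.1.1; p.1.2; p.2]`_i.

Lemma measurable_row3 : measurable_fun setT row3.
Proof.
apply/measurable_fun_rVP => i.
case: i => -[|[|[|//]]] i3.
- rewrite (_ : (fun x => _) = fst \o fst); first exact: measurableT_comp.
  by apply/funext => p; rewrite !mxE.
- rewrite (_ : (fun x => _) = snd \o fst); first exact: measurableT_comp.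
  by apply/funext => p; rewrite !mxE.
- rewrite (_ : (fun x => _) = snd); first exact: measurable_snd.
  by apply/funext => p; rewrite !mxE.
Qed.

Let leb : {sigma_finite_measure set (measurableTypeR R) -> \bar R} :=
  lebesgue_measure.

Definition lebesgue3 : {measure set 'rV[R]_3 -> \bar R} :=
  measure_function_pushforward__canonical__measure_function_Measure
    ((leb \x leb)%E \x leb)%E measurable_row3.

End lebesgue3.

(* States are row vectors: a matrix M acts on v as v *m M^T. *)
Section lorenz.
Context (R : realType) (a b r : R).

Definition lorenzA : 'M[R]_3 :=
  \matrix_(i < 3, j < 3)
    (nth [::] [:: [:: a; - a; 0];
                  [:: a;   1; 0];
                  [:: 0;   0; b]] i)`_j.

Definition lorenzB (u u' : 'rV[R]_3) : 'rV[R]_3 :=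
  \row_(i < 3) [:: 0;
                   (u 0 0 * u' 0 2 + u 0 2 * u' 0 0) / 2;
                   - ((u 0 0 * u' 0 1 + u 0 1 * u' 0 0) / 2)]`_i.

Definition lorenzf : 'rV[R]_3 := \row_(i < 3) [:: 0; 0; - (b * (r + a))]`_i.

Definition lorenz (v : 'rV[R]_3) : 'rV[R]_3 :=
  - (v *m lorenzA^T) - lorenzB v v + lorenzf.

End lorenz.

(* [Psi] is the flow of du/dt = F u. Trajectories exist on a neighbourhood of
   [0, +oo[ (so that derivatives at time 0 are two-sided), and Psi (- t) is the
   inverse of Psi t on its range. Values of Psi at negative times where the
   trajectory has already blown up are left unspecified. *)
Definition is_flow (R : realType) (F : 'rV[R]_3 -> 'rV[R]_3)
    (Psi : R -> 'rV[R]_3 -> 'rV[R]_3) : Prop :=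
  [/\ forall v, Psi 0 v = v,
      forall v, exists2 e : R, 0 < e &
        forall t : R, - e < t -> is_derive t 1 (Psi ^~ v) (F (Psi t v)) &
      forall t v, 0 <= t -> Psi (- t) (Psi t v) = v].

Definition absorbing_radius (R : realType) (F : 'rV[R]_3 -> 'rV[R]_3)
    (rad : R) : Prop :=
  0 < rad /\ exists2 delta : R, 0 < delta &
    forall v, rad <= enorm v <= rad + delta -> dot (F v) v <= 0.

Section observations.
Context (R : realType).
Implicit Types (Psi : R -> 'rV[R]_3 -> 'rV[R]_3) (u v z : 'rV[R]_3).

Definition obsH : 'M[R]_3 := diag_mx (delta_mx 0 0).

Definition obs v : 'rV[R]_3 := v *m obsH^T.

(* D^i v *)
Definition timeD Psi (i : nat) v : 'rV[R]_3 := derive1n i (Psi ^~ v) 0.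

Definition gradient (g : 'rV[R]_3 -> R) u : 'rV[R]_3 :=
  \row_(m < 3) 'D_(delta_mx 0 m) g u.

Definition obs_time (h : R) (i : nat) : R := i%:R * h.

Definition smoother_weight Psi (rad : R) (q eta : 'rV[R]_3 -> R)
    (h : R) (k : nat) (Y : nat -> 'rV[R]_3) v : R :=
  if v \in cball rad then
    q v * \prod_(i < k.+1) eta (Y i - obs (Psi (obs_time h i) v))
  else 0.

(* 'J is the transpose of the usual Jacobian matrix, with the same
   determinant. *)
Definition filter_weight Psi (rad : R) (q eta : 'rV[R]_3 -> R)
    (h : R) (k : nat) (Y : nat -> 'rV[R]_3) v : R :=
  let tk := obs_time h k in
  if v \in Psi tk @` cball rad then
    (\prod_(i < k.+1) eta (Y i - obs (Psi (obs_time h i - tk) v)))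
    * \det ('J (Psi (- tk)) v) * q (Psi (- tk) v)
  else 0.

(* The normalising constant c is left free: it is immaterial for supports, and
   no convention is then needed for weights that cannot be normalised. *)
Definition proportional (m w : 'rV[R]_3 -> R) : Prop :=
  exists2 c : R, 0 < c & forall v, m v = c * w v.

Definition is_smoother Psi rad q eta h k Y (m : 'rV[R]_3 -> R) : Prop :=
  proportional m (smoother_weight Psi rad q eta h k Y).

Definition is_filter Psi rad q eta h k Y (m : 'rV[R]_3 -> R) : Prop :=
  proportional m (filter_weight Psi rad q eta h k Y).

Definition is_density (p : 'rV[R]_3 -> R) : Prop :=
  [/\ measurable_fun setT p, forall z, 0 <= p z &
      (\int[@lebesgue3 R]_z (p z)%:E = 1)%E].

End observations.

Section noise.
Context (R : realType) d (Omega : measurableType d) (P : probability Omega R).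

(* Independence of the whole sequence: it suffices to consider the initial
   segments, since some of the S i can be the whole space. *)
Definition mutually_independent (Z : nat -> {RV P >-> 'rV[R]_3}) : Prop :=
  forall (n : nat) (S : nat -> set 'rV[R]_3), (forall i, measurable (S i)) ->
    P (\bigcap_(i in `I_n) (Z i @^-1` S i)) =
    (\prod_(i < n) fine (P (Z i @^-1` S i)))%:E.

Definition has_density (X : {RV P >-> 'rV[R]_3}) (p : 'rV[R]_3 -> R) : Prop :=
  forall S : set 'rV[R]_3, measurable S ->
    P (X @^-1` S) = (\int[@lebesgue3 R]_(z in S) (p z)%:E)%E.

Definition centered (X : {RV P >-> 'rV[R]_3}) : Prop :=
  forall l : 'I_3,
    P.-integrable setT (fun w => (X w 0 l)%:E) /\
    ('E_P[fun w => (X w 0 l)%R] = 0)%E.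

Definition iid_noise (eta : 'rV[R]_3 -> R) (Z : nat -> {RV P >-> 'rV[R]_3}) :
    Prop :=
  [/\ is_density eta, mutually_independent Z,
      forall i, has_density (Z i) eta & forall i, centered (Z i)].

Definition observation (Psi : R -> 'rV[R]_3 -> 'rV[R]_3) (u : 'rV[R]_3) (h : R)
    (Z : nat -> {RV P >-> 'rV[R]_3}) (i : nat) (w : Omega) : 'rV[R]_3 :=
  obs (Psi (obs_time h i) u) + Z i w.

End noise.

(* Main.v *)
Require Import Defs.
From HB Require Import structures.
From mathcomp Require Import all_boot all_order all_algebra.
From mathcomp Require Import all_classical all_reals all_analysis.
From mathcomp Require Import measurable_realfun ring lra.

Set Implicit Arguments.
Unset Strict Implicit.
Unset Printing Implicit Defensive.

Import Order.TTheory GRing.Theory Num.Theory.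
Import numFieldNormedType.Exports.

Local Open Scope classical_set_scope.
Local Open Scope ring_scope.

(** The first observed coordinate and its first two time derivatives are [u0],
    [a (u1 - u0)] and [- a ((1 + a) u1 + u0 u2)]. As long as [u0 != 0], these
    determine [u0], then [u1], then [u2], and their gradients are linearly
    independent. The plane [u0 = 0] and the sphere of radius [rad] are null
    sets, which settles identifiability.

    To pass from derivatives to samples, let [v] be another point of the ball.
    The difference of the two observed trajectories is a scalar function [g] of
    time, and its third derivative is at most a constant times [enorm (v - u)]:
    that derivative is a polynomial in the state, hence Lipschitz on the ball;
    the ball is invariant ([cball_invariant]); and trajectories separate at most
    exponentially ([solves_stable]). By Taylor's formula, the values of [g] at
    [0], [h] and [2 h] give [g 0], [g' 0] and [g'' 0], and hence [v - u], up to
    an error of order [h * enorm (v - u)], which can be absorbed when [h] is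
    small. This yields [observability]: on the ball, [enorm (v - u)] is at most
    a constant times the sum of the differences between the three samples.

    When the errors are bounded by [eps], every point of the support of the
    smoother has samples within [2 * eps] of those of [u], so it lies within a
    multiple of [eps] of [u]. The points of the support of the filter are images
    of such points under the flow, which is Lipschitz.

    For square-integrable errors, a point that nearly minimises the misfit to
    the data has samples at a distance from those of [u] controlled by the sum
    of the sizes of the errors; by [observability] it is that close to [u], and
    taking squares and expectations gives the bound. To stay measurable, the
    estimator takes for each coordinate the infimum, over decreasing tolerances,
    of its supremum over those rational points of the ball that minimise the
    misfit up to the tolerance ([near_min_target]). *)

(** * Coordinates and the Euclidean norm *)

Section coordinates.
Context (R : realType).
Implicit Types u v : 'rV[R]_3.

Lemma ord3P (P : 'I_3 -> Prop) : P 0 -> P 1 -> P 2 -> forall i, P i.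
Proof.
move=> P0 P1 P2 [[|[|[|//]]] i3].
- by rewrite (_ : Ordinal i3 = 0) //; exact: val_inj.
- by rewrite (_ : Ordinal i3 = 1) //; exact: val_inj.
- by rewrite (_ : Ordinal i3 = 2) //; exact: val_inj.
Qed.

Lemma big_ord3 (f : 'I_3 -> R) : \sum_(i < 3) f i = f 0 + f 1 + f 2.
Proof.
rewrite !big_ord_recl big_ord0 addr0 addrA.
by congr (f _ + f _ + f _); apply: val_inj.
Qed.

Lemma rV3P u v :
  u 0 0 = v 0 0 -> u 0 1 = v 0 1 -> u 0 2 = v 0 2 -> u = v.
Proof. by move=> *; apply/rowP; apply: ord3P. Qed.

Lemma coordD u v i : (u + v) 0 i = u 0 i + v 0 i.
Proof. by rewrite !mxE. Qed.

Lemma coordB u v i : (u - v) 0 i = u 0 i - v 0 i.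
Proof. by rewrite !mxE. Qed.

Lemma dotE u v : dot u v = u 0 0 * v 0 0 + u 0 1 * v 0 1 + u 0 2 * v 0 2.
Proof. exact: big_ord3. Qed.

Lemma dot_ge0 u : 0 <= dot u u.
Proof. by rewrite dotE; nra. Qed.

Lemma enorm_ge0 u : 0 <= enorm u.
Proof. exact: sqrtr_ge0. Qed.

Lemma sqr_enorm u : enorm u ^+ 2 = dot u u.
Proof. by rewrite sqr_sqrtr // dot_ge0. Qed.

Lemma enorm_le u (c : R) : 0 <= c -> (enorm u <= c) = (dot u u <= c ^+ 2).
Proof. by move=> c0; rewrite -sqr_enorm ler_sqr // nnegrE enorm_ge0. Qed.

Lemma normr_coord_le u i : `|u 0 i| <= enorm u.
Proof.
rewrite -(@ler_sqr R) ?nnegrE ?enorm_ge0 // real_normK ?num_real // sqr_enorm.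
by move: i; apply: ord3P; rewrite dotE; nra.
Qed.

Lemma enorm_le_sum u : enorm u <= `|u 0 0| + `|u 0 1| + `|u 0 2|.
Proof.
rewrite enorm_le ?addr_ge0 // dotE.
have := normr_ge0 (u 0 0); have := normr_ge0 (u 0 1).
have := normr_ge0 (u 0 2).
have sq x : x * x = `|x| ^+ 2 :> R by rewrite real_normK ?num_real // expr2.
by rewrite !sq; nra.
Qed.

Lemma enormZ (c : R) u : 0 <= c -> enorm (c *: u) = c * enorm u.
Proof.
move=> c0; rewrite /enorm (_ : dot _ _ = c ^+ 2 * dot u u).
  by rewrite sqrtrM ?sqr_ge0 // sqrtr_sqr ger0_norm.
by rewrite !dotE !mxE; ring.
Qed.

Lemma enorm0 : enorm (0 : 'rV[R]_3) = 0.
Proof. by rewrite /enorm dotE !mxE !mulr0 !addr0 sqrtr0. Qed.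

Lemma enormN u : enorm (- u) = enorm u.
Proof. by rewrite /enorm !dotE !mxE !mulrNN. Qed.

Lemma enormBC u v : enorm (u - v) = enorm (v - u).
Proof. by rewrite -enormN opprB. Qed.

Lemma ler_enormD u v : enorm (u + v) <= enorm u + enorm v.
Proof.
rewrite enorm_le ?addr_ge0 ?enorm_ge0 //.
rewrite sqrrD !sqr_enorm.
suff CS : dot u v <= enorm u * enorm v.
  by rewrite !dotE in CS *; rewrite !mxE; lra.
apply: le_trans (ler_norm _) _.
rewrite -(@ler_sqr R) ?nnegrE ?mulr_ge0 ?enorm_ge0 //.
rewrite real_normK ?num_real // exprMn !sqr_enorm !dotE.
set a0 := u 0 0; set a1 := u 0 1; set a2 := u 0 2.
set b0 := v 0 0; set b1 := v 0 1; set b2 := v 0 2.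
rewrite -subr_ge0 (_ : _ - _ = (a0 * b1 - a1 * b0) ^+ 2 +
  (a0 * b2 - a2 * b0) ^+ 2 + (a1 * b2 - a2 * b1) ^+ 2); last by ring.
by rewrite !addr_ge0 ?sqr_ge0.
Qed.

Lemma ler_enormB u v w : enorm (u - v) <= enorm (u - w) + enorm (v - w).
Proof.
rewrite (enormBC v w); apply: le_trans _ (ler_enormD _ _).
by rewrite addrA subrK.
Qed.

Lemma enormB_le0 u v : enorm (u - v) <= 0 -> u = v.
Proof.
move=> uv; have c i : u 0 i = v 0 i.
  apply/eqP; rewrite -subr_eq0 -normr_le0.
  by have := le_trans (normr_coord_le (u - v) i) uv; rewrite !mxE.
exact: rV3P.
Qed.

Lemma obsE u l : obs u 0 l = if l == 0 then u 0 0 else 0.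
Proof.
rewrite /obs /obsH mxE big_ord3.
by move: l; apply: ord3P; rewrite !mxE /= ?mulr1n ?mulr0n; ring.
Qed.

End coordinates.

(** * Differential calculus *)

Section derivatives.
Context (R : realType) (V : normedModType R).
Implicit Types (f g : V -> R) (x v : V).

Lemma is_derive_coord (f : V -> 'rV[R]_3) x v df i :
  is_derive x v f df -> is_derive x v (fun y => f y 0 i) (df 0 i).
Proof.
move=> [fd <-]; rewrite derive_mx // mxE.
by apply: DeriveDef => //; move/derivable_mxP : fd; exact.
Qed.

Lemma is_derive_add f g x v df dg :
  is_derive x v f df -> is_derive x v g dg ->
  is_derive x v (fun y => f y + g y) (df + dg).
Proof. by move=> ? ?; exact: is_deriveD. Qed.

Lemma is_derive_opp f x v df :
  is_derive x v f df -> is_derive x v (fun y => - f y) (- df).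
Proof. by move=> ?; exact: is_deriveN. Qed.

Lemma is_derive_mul f g x v df dg :
  is_derive x v f df -> is_derive x v g dg ->
  is_derive x v (fun y => f y * g y) (df * g x + f x * dg).
Proof.
move=> ? ?; apply: (is_derive_eq (is_deriveM _ _)).
by rewrite addrC /GRing.scale /= mulrC.
Qed.

Lemma is_derive_const (c : R) x v : is_derive x v (fun=> c) 0.
Proof. exact: is_derive_cst. Qed.

End derivatives.

(* The premises are left to [derive_step] itself: instance search would find
   them too, but with derivatives in a less predictable form. *)
Ltac derive_step :=
  first [ eassumption
        | notypeclasses refine (is_derive_add _ _)
        | notypeclasses refine (is_derive_opp _)
        | notypeclasses refine (is_derive_mul _ _)
        | notypeclasses refine (is_derive_const _ _ _) ].

(** Differentiates a polynomial expression in functions whose derivatives are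
    among the hypotheses, leaving the comparison of the two formulas. *)
Ltac derive_poly :=
  notypeclasses refine (is_derive_eq _ _); [repeat derive_step | rewrite /= ].

Section mean_value.
Context (R : realType).
Implicit Types (f df : R -> R) (s t x y : R).

Lemma mean_value f df (s t : R) : s < t ->
  (forall y, s <= y <= t -> is_derive y 1 f (df y)) ->
  exists2 c, s < c < t & f t - f s = df c * (t - s).
Proof.
move=> st fd; have [||c] := @MVT R f df s t st.
- move=> y; rewrite in_itv /= => /andP[/ltW sy /ltW yt].
  by apply: fd; rewrite sy.
- apply: derivable_within_continuous => y; rewrite in_itv /= => syt.
  by have [] := fd y syt.
- by rewrite in_itv /= => cst ->; exists c.
Qed.

Lemma ler_norm_increment f df (T M : R) : 0 <= T ->
  (forall y, 0 <= y <= T -> is_derive y 1 f (df y)) ->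
  (forall y, 0 <= y <= T -> `|df y| <= M) -> `|f T - f 0| <= M * T.
Proof.
rewrite le_eqVlt => /orP[/eqP <-|T0] fd dfM.
  by rewrite subrr normr0 mulr0.
have [c /andP[c0 cT] ->] := mean_value T0 fd.
by rewrite subr0 normrM (ger0_norm (ltW T0)) ler_pM2r // dfM // !ltW.
Qed.

(** If [f] exceeded the level [c], it would have done so without increasing
    since the last time at which it was at most [c]. *)
Lemma le_level f df (c : R) :
  (forall y, 0 <= y -> is_derive y 1 f (df y)) ->
  (forall y, 0 <= y -> c < f y -> df y <= 0) ->
  f 0 <= c -> forall t, 0 <= t -> f t <= c.
Proof.
move=> fd dfle f0 t t0; rewrite leNgt; apply/negP => ft.
pose S := [set s | 0 <= s <= t /\ f s <= c].
have S0 : S 0 by split => //; rewrite lexx.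
have hsS : has_sup S.
  by split; [exists 0|exists t => s [/andP[_]]].
pose s := sup S.
have s0 : 0 <= s by exact: (ub_le_sup (proj2 hsS)).
have st : s <= t by apply: ge_sup => [|y [/andP[_]]] //; exists 0.
have cf : {for s, continuous f}.
  apply: differentiable_continuous; apply/derivable1_diffP.
  by have [] := fd s s0.
have fs : f s <= c.
  rewrite leNgt; apply/negP => cfs.
  have /nbhs_ballP[e /= e0 He] : nbhs s (f @^-1` [set y : R | c < y]).
    by apply: cf; exact: (open_nbhs_nbhs (conj (open_gt (y := c)) cfs)).
  have [y Sy sy] := sup_adherent e0 hsS.
  have ys : y <= s by exact: (ub_le_sup (proj2 hsS)).
  have /He /= : ball s e y.
    by rewrite -/s in sy; rewrite /ball /= ger0_norm ?subr_ge0 //; lra.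
  by case: Sy => _ /le_lt_trans h /h; rewrite ltxx.
have {}st : s < t.
  by rewrite lt_neqAle st andbT; apply: contraTneq ft => <-; rewrite -leNgt.
have [|x /andP[sx xt] fx] := mean_value st (df := df) (f := f).
  by move=> y /andP[sy _]; apply: fd; exact: le_trans sy.
have x0 : 0 <= x by apply: le_trans s0 (ltW sx).
have cx : c < f x.
  rewrite ltNge; apply/negP => fxc.
  have : x <= s.
    by apply: (ub_le_sup (proj2 hsS)); split => //; rewrite x0 ltW.
  by rewrite leNgt sx.
have : df x * (t - s) <= 0 by rewrite mulr_le0_ge0 ?dfle // subr_ge0 ltW.
by rewrite -fx; lra.
Qed.

Lemma gronwall f df (K : R) :
  (forall y, 0 <= y -> is_derive y 1 f (df y)) ->
  (forall y, 0 <= y -> df y <= K * f y) ->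
  forall t, 0 <= t -> f t <= expR (K * t) * f 0.
Proof.
move=> fd dfK t; rewrite le_eqVlt => /orP[/eqP <-|t0].
  by rewrite mulr0 expR0 mul1r.
have ed y : is_derive y 1 (fun y => expR (- (K * y))) (- K * expR (- (K * y))).
  have yd := is_derive_id y (1 : R).
  have Kd : is_derive y 1 (fun y => - (K * y)) (- K).
    by derive_poly; ring.
  have := @is_derive1_comp R expR _ y _ _ (is_derive_expR _) Kd.
  by rewrite mulrC.
have [|c /andP[c0 _]] := mean_value (f := fun y => expR (- (K * y)) * f y)
    (df := fun y => - K * expR (- (K * y)) * f y + expR (- (K * y)) * df y) t0.
  by move=> y /andP[y0 _]; apply: is_derive_mul => //; exact: fd.
rewrite mulr0 oppr0 expR0 mul1r => E.
have : expR (- (K * t)) * f t <= f 0.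
  rewrite -subr_le0 E mulr_le0_ge0 ?addr0 ?(ltW t0) //.
  rewrite -mulrA mulrCA -mulrDr mulr_ge0_le0 ?expR_ge0 //.
  by have := dfK c (ltW c0); lra.
by rewrite expRN mulrC ler_pdivrMr ?expR_gt0 // mulrC.
Qed.

End mean_value.

(** * Trajectories of the Lorenz system *)

Section trajectories.
Context (R : realType) (a b r rad : R).
Hypotheses (a_gt0 : 0 < a) (b_gt0 : 0 < b).
Hypothesis radP : absorbing_radius (lorenz a b r) rad.
Implicit Types (u v : 'rV[R]_3) (x y : R -> 'rV[R]_3) (s t : R).

Local Notation F := (lorenz a b r).

Lemma lorenzE0 v : F v 0 0 = a * (v 0 1 - v 0 0).
Proof. by rewrite !mxE big_ord3 !mxE /=; ring. Qed.

Lemma lorenzE1 v : F v 0 1 = - a * v 0 0 - v 0 1 - v 0 0 * v 0 2.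
Proof. by rewrite !mxE big_ord3 !mxE /=; field. Qed.

Lemma lorenzE2 v :
  F v 0 2 = - b * v 0 2 + v 0 0 * v 0 1 - b * (r + a).
Proof. by rewrite !mxE big_ord3 !mxE /=; field. Qed.

Definition lorenzE := (lorenzE0, lorenzE1, lorenzE2).

Let rad_gt0 : 0 < rad. Proof. by case: radP. Qed.
Let rad_ge0 : 0 <= rad. Proof. exact: ltW. Qed.

(** The quadratic part of the field does no work, so along a ray the power
    [dot (F v) v] is a concave quadratic polynomial vanishing at the origin:
    once non-positive, it stays so further out. *)
Lemma lorenz_inward v : rad <= enorm v -> dot (F v) v <= 0.
Proof.
move=> radv; have v0 : 0 < enorm v by exact: lt_le_trans radv.
have [_ [delta delta0 inward]] := radP.
pose c := rad / enorm v.
have c0 : 0 < c by rewrite divr_gt0.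
have c1 : c <= 1 by rewrite ler_pdivrMr // mul1r.
have cv : enorm (c *: v) = rad.
  by rewrite enormZ ?(ltW c0) // /c divfK // (gt_eqF v0).
have := inward (c *: v); rewrite cv lexx lerDl ltW // => /(_ isT).
pose Q := a * v 0 0 ^+ 2 + v 0 1 ^+ 2 + b * v 0 2 ^+ 2.
pose L := b * (r + a) * v 0 2.
have Q0 : 0 <= Q.
  by rewrite /Q !addr_ge0 // ?sqr_ge0 // mulr_ge0 ?sqr_ge0 // ltW.
have -> : dot (F (c *: v)) (c *: v) = c * (- c * Q - L).
  by rewrite dotE !lorenzE !mxE /Q /L; ring.
have -> : dot (F v) v = - Q - L by rewrite dotE !lorenzE /Q /L; ring.
by rewrite pmulr_rle0 //; nra.
Qed.

(** Differentiability at time [0] is two-sided. *)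
Definition solves x := forall t, 0 <= t -> is_derive t 1 x (F (x t)).

Lemma flow_solves Psi v : is_flow F Psi -> solves (Psi ^~ v).
Proof.
by case=> _ /(_ v)[e e0 dPsi] _ t t0; apply: dPsi; apply: lt_le_trans t0; lra.
Qed.

Lemma solves_shift x s : 0 <= s -> solves x -> solves (fun t => x (t + s)).
Proof.
move=> s0 sx t t0.
have [dx <-] := sx (t + s) (addr_ge0 t0 s0).
have E : (fun h => h^-1 *: (x (h *: 1 + t + s) - x (t + s))) =
         (fun h => h^-1 *: (x (h *: 1 + (t + s)) - x (t + s))).
  by apply/funext => h; rewrite addrA.
by apply: DeriveDef; rewrite /derivable /derive /= E.
Qed.

Lemma solves_coord x t : solves x -> 0 <= t ->
  [/\ is_derive t 1 (fun s => x s 0 0) (F (x t) 0 0),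
      is_derive t 1 (fun s => x s 0 1) (F (x t) 0 1) &
      is_derive t 1 (fun s => x s 0 2) (F (x t) 0 2)].
Proof. by move=> sx t0; split; exact: is_derive_coord (sx _ t0). Qed.

Lemma cball_invariant x : solves x -> cball rad (x 0) ->
  forall t, 0 <= t -> cball rad (x t).
Proof.
move=> sx; rewrite /cball /= enorm_le // => x0 t t0; rewrite enorm_le //.
pose f s := x s 0 0 * x s 0 0 + x s 0 1 * x s 0 1 + x s 0 2 * x s 0 2.
have fE s : f s = dot (x s) (x s) by rewrite dotE.
rewrite -fE; apply: (@le_level _ f (fun s => 2 * dot (F (x s)) (x s))) => //.
- move=> s s0; have [d0 d1 d2] := solves_coord sx s0.
  by derive_poly; rewrite dotE; ring.
- move=> s s0; rewrite fE => rads.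
  rewrite pmulr_rle0 //; apply: lorenz_inward; apply: ltW.
  by rewrite ltNge enorm_le // -ltNge.
- by rewrite fE.
Qed.

(** The energy-preserving nonlinearity contributes to the squared distance of
    two trajectories only the terms [d0 * (u 0 1 * d2 - u 0 2 * d1)], where
    [d] is the difference [u - v]: only one of the two has to be bounded. *)
Lemma lorenz_dissipation u v : cball rad u ->
  2 * dot (F u - F v) (u - v) <= 2 * rad * dot (u - v) (u - v).
Proof.
move=> uB.
have u1 : `|u 0 1| <= rad by exact: le_trans (normr_coord_le _ _) uB.
have u2 : `|u 0 2| <= rad by exact: le_trans (normr_coord_le _ _) uB.
rewrite !dotE !coordB !lorenzE.
set d0 := u 0 0 - v 0 0; set d1 := u 0 1 - v 0 1; set d2 := u 0 2 - v 0 2.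
have bnd (c p q : R) :
    `|c| <= rad -> 2 * (c * (p * q)) <= rad * (p ^+ 2 + q ^+ 2).
  rewrite ler_norml => /andP[cl cu].
  have h1 : 0 <= (rad - c) * (p + q) ^+ 2.
    by rewrite mulr_ge0 ?sqr_ge0 // subr_ge0.
  have h2 : 0 <= (rad + c) * (p - q) ^+ 2.
    by rewrite mulr_ge0 ?sqr_ge0 // -lerBlDl sub0r.
  by lra.
have h1 := bnd _ d0 d2 u1; have h2 := bnd _ d0 (- d1) u2.
have D : 0 <= a * d0 ^+ 2 + d1 ^+ 2 + b * d2 ^+ 2.
  by rewrite !addr_ge0 // ?sqr_ge0 // mulr_ge0 ?sqr_ge0 // ltW.
have D1 := mulr_ge0 rad_ge0 (sqr_ge0 d1).
have D2 := mulr_ge0 rad_ge0 (sqr_ge0 d2).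
rewrite -subr_ge0.
move: h1 h2; rewrite -subr_ge0 => h1; rewrite -subr_ge0 => h2.
suff E : 2 * rad * (d0 * d0 + d1 * d1 + d2 * d2) - 2 * (
   (a * (u 0 1 - u 0 0) - a * (v 0 1 - v 0 0)) * d0 +
   (- a * u 0 0 - u 0 1 - u 0 0 * u 0 2 -
    (- a * v 0 0 - v 0 1 - v 0 0 * v 0 2)) * d1 +
   (- b * u 0 2 + u 0 0 * u 0 1 - b * (r + a) -
    (- b * v 0 2 + v 0 0 * v 0 1 - b * (r + a))) * d2) =
   2 * (a * d0 ^+ 2 + d1 ^+ 2 + b * d2 ^+ 2) + rad * d1 ^+ 2 + rad * d2 ^+ 2 +
   (rad * (d0 ^+ 2 + d2 ^+ 2) - 2 * (u 0 1 * (d0 * d2))) +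
   (rad * (d0 ^+ 2 + (- d1) ^+ 2) - 2 * (u 0 2 * (d0 * - d1))).
  by rewrite E; lra.
by rewrite /d0 /d1 /d2; ring.
Qed.

Lemma solves_stable x y : solves x -> solves y -> cball rad (x 0) ->
  forall t, 0 <= t -> enorm (x t - y t) <= expR (rad * t) * enorm (x 0 - y 0).
Proof.
move=> sx sy x0 t t0; rewrite enorm_le ?mulr_ge0 ?expR_ge0 ?enorm_ge0 //.
rewrite exprMn sqr_enorm -expRM_natl mulrA.
pose f s := (x s 0 0 - y s 0 0) * (x s 0 0 - y s 0 0) +
  (x s 0 1 - y s 0 1) * (x s 0 1 - y s 0 1) +
  (x s 0 2 - y s 0 2) * (x s 0 2 - y s 0 2).
have fE s : f s = dot (x s - y s) (x s - y s) by rewrite dotE !mxE.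
rewrite -!fE.
apply: (@gronwall _ f (fun s => 2 * dot (F (x s) - F (y s)) (x s - y s))) => //.
- move=> s s0; have [d0 d1 d2] := solves_coord sx s0.
  have [e0 e1 e2] := solves_coord sy s0.
  derive_poly; rewrite dotE !coordB; ring.
- move=> s s0; rewrite fE; apply: lorenz_dissipation.
  exact: cball_invariant.
Qed.

(** Trajectories are unique by [solves_stable] with equal initial points. *)
Lemma flow_semigroup Psi v s t : is_flow F Psi -> cball rad v ->
  0 <= s -> 0 <= t -> Psi (t + s) v = Psi t (Psi s v).
Proof.
move=> flowPsi vB s0 t0; have [Psi0 _ _] := flowPsi.
have sv := flow_solves v flowPsi.
have vsB : cball rad (Psi s v) by apply: (cball_invariant sv); rewrite ?Psi0.
apply: enormB_le0.
apply: le_trans (solves_stable (solves_shift s0 sv)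
  (flow_solves (Psi s v) flowPsi) _ t0) _; rewrite add0r //.
by rewrite Psi0 subrr enorm0 mulr0.
Qed.

(** The first coordinate and its first three derivatives along the flow. *)
Definition obsD (i : nat) v : R :=
  match i with
  | 0 => v 0 0
  | 1 => a * (v 0 1 - v 0 0)
  | 2 => - a * ((1 + a) * v 0 1 + v 0 0 * v 0 2)
  | _ => - a * ((1 + a) * F v 0 1 + F v 0 0 * v 0 2 + v 0 0 * F v 0 2)
  end.

Lemma is_derive_obsD x t i : (i < 3)%N -> is_derive t 1 x (F (x t)) ->
  is_derive t 1 (fun s => obsD i (x s)) (obsD i.+1 (x t)).
Proof.
move=> i3 dx.
have d0 := is_derive_coord 0 dx; have d1 := is_derive_coord 1 dx.
have d2 := is_derive_coord 2 dx.
case: i i3 => [|[|[|//]]] _ /=; derive_poly; rewrite !lorenzE; ring.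
Qed.

Lemma obs_timeD Psi i v : is_flow F Psi -> (i < 3)%N ->
  obs (timeD Psi i v) 0 0 = obsD i v.
Proof.
move=> [Psi0 /(_ v)[e e0 dPsi] _]; rewrite obsE eqxx /timeD.
have d1 t : - e < t -> (Psi ^~ v)^`()%classic t = F (Psi t v).
  by move=> te; rewrite derive1E; have [_ ->] := dPsi t te.
have e0' : - e < 0 by rewrite oppr_lt0.
case: i => [|[|[|//]]] _.
- by rewrite derive1n0 Psi0.
- by rewrite derive1n1 d1 // Psi0 lorenzE0.
have Fd : derivable (fun t => F (Psi t v)) 0 1.
  have d0' := is_derive_coord 0 (dPsi 0 e0').
  have d1' := is_derive_coord 1 (dPsi 0 e0').
  have d2' := is_derive_coord 2 (dPsi 0 e0').
  apply/derivable_mxP => i j; rewrite ord1; move: j; apply: ord3P.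
  - under eq_fun do rewrite lorenzE0.
    by apply: ex_derive; derive_poly; reflexivity.
  - under eq_fun do rewrite lorenzE1.
    by apply: ex_derive; derive_poly; reflexivity.
  - under eq_fun do rewrite lorenzE2.
    by apply: ex_derive; derive_poly; reflexivity.
rewrite derive1nS derive1n1 derive1E.
rewrite (@near_eq_derive _ _ _ _ (fun t => F (Psi t v))); last first.
  by near=> t; apply: d1; near: t; exact: lt_nbhsr.
rewrite derive_mx // mxE.
rewrite (_ : (fun t => F (Psi t v) 0 0) = (fun t => obsD 1 (Psi t v))).
  2: by apply/funext => t; rewrite lorenzE0.
have [_ ->] := @is_derive_obsD (Psi ^~ v) 0 1 isT (dPsi 0 e0').
by rewrite Psi0.
Unshelve. all: by end_near. Qed.

End trajectories.

(** * Recovering the state from three observations *)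

Section taylor.
Context (R : realType).
Implicit Types t x y z : R.

(** The constant [6] of the sharp bound is given up so that each of the three
    integrations is one use of the mean value theorem. *)
Lemma taylor2 (g g1 g2 g3 : R -> R) (T M : R) : 0 <= T ->
  (forall t, 0 <= t -> is_derive t 1 g (g1 t)) ->
  (forall t, 0 <= t -> is_derive t 1 g1 (g2 t)) ->
  (forall t, 0 <= t -> is_derive t 1 g2 (g3 t)) ->
  (forall t, 0 <= t <= T -> `|g3 t| <= M) ->
  `|g T - g 0 - T * g1 0 - T ^+ 2 / 2 * g2 0| <= M * T ^+ 3.
Proof.
move=> T0 dg dg1 dg2 g3M.
have M0 : 0 <= M by rewrite (le_trans _ (g3M 0 _)) ?lexx.
have yd (y : R) := is_derive_id y (1 : R).
have h2 y : 0 <= y <= T -> `|g2 y - g2 0| <= M * T.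
  move=> /andP[y0 yT]; apply: (@le_trans _ _ (M * y)); last exact: ler_wpM2l.
  apply: (ler_norm_increment (df := g3)) => // z /andP[z0 zy]; first exact: dg2.
  by apply: g3M; rewrite z0 (le_trans zy).
pose p1 y := g1 y + - (y * g2 0).
have h1 y : 0 <= y <= T -> `|g1 y - g1 0 - y * g2 0| <= M * T ^+ 2.
  move=> /andP[y0 yT]; apply: (@le_trans _ _ (M * T * y)).
    rewrite (_ : _ - _ = p1 y - p1 0); last by rewrite /p1; ring.
    apply: (ler_norm_increment (df := fun y => g2 y - g2 0)) => //
      z /andP[z0 zy].
      by have e1 := dg1 z z0; have e := yd z; derive_poly; ring.
    by apply: h2; rewrite z0 (le_trans zy).
  by rewrite expr2 mulrA ler_wpM2l // mulr_ge0.
pose p y := g y + - (y * g1 0) + - (y * y * (g2 0 / 2)).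
rewrite (_ : _ - _ = p T - p 0); last by rewrite /p; field.
apply: (@le_trans _ _ (M * T ^+ 2 * T)); last by rewrite -mulrA -exprSr.
apply: (ler_norm_increment (df := fun y => g1 y - g1 0 - y * g2 0)) => //.
move=> z /andP[z0 zT]; have e0 := dg z z0; have e := yd z.
by derive_poly; field.
Qed.

(** Three equidistant values determine the 2-jet of [g], up to the Taylor
    remainders. *)
Lemma jet_le_values (g0 g1 g2 D0 D1 D2 h M : R) : 0 < h <= 1 ->
  g0 = D0 ->
  `|g1 - D0 - h * D1 - h ^+ 2 / 2 * D2| <= M * h ^+ 3 ->
  `|g2 - D0 - (2 * h) * D1 - (2 * h) ^+ 2 / 2 * D2| <= M * (2 * h) ^+ 3 ->
  h ^+ 2 * (`|D0| + `|D1| + `|D2|) <=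
    5 * (`|g0| + `|g1| + `|g2|) + 16 * M * h ^+ 3.
Proof.
move=> /andP[h0 h1] g0E; set E1 := _ - h ^+ 2 / 2 * D2; set E2 := _ - _ * D2.
rewrite exprMn => E1M E2M.
have lb x : - `|x| <= x by rewrite lerNl -normrN ler_norm.
have := (lb g0, lb g1, lb g2, lb E1, lb E2).
move=> [[[[lb0 lb1] lb2] lbE1] lbE2].
have := (ler_norm g0, ler_norm g1, ler_norm g2, ler_norm E1, ler_norm E2).
move=> [[[[ub0 ub1] ub2] ubE1] ubE2].
(* Finite differences that are exact on quadratics, hence on everything but the
   remainders [E1] and [E2]. *)
have B1 : `|2 * h * D1| <= 4 * `|g1| + `|g2| + 3 * `|g0| + 4 * `|E1| + `|E2|.
  rewrite (_ : 2 * h * D1 = 4 * g1 - g2 - 3 * g0 - 4 * E1 + E2); last first.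
    by rewrite /E1 /E2 g0E; field.
  by rewrite ler_norml; apply/andP; split; lra.
have B2 : `|h ^+ 2 * D2| <= `|g2| + 2 * `|g1| + `|g0| + `|E2| + 2 * `|E1|.
  rewrite (_ : h ^+ 2 * D2 = g2 - 2 * g1 + g0 - E2 + 2 * E1); last first.
    by rewrite /E1 /E2 g0E; field.
  by rewrite ler_norml; apply/andP; split; lra.
have n0 := normr_ge0 g0; have n1 := normr_ge0 g1; have n2 := normr_ge0 g2.
rewrite (_ : _ * (_ * _) = 8 * (M * h ^+ 3)) in E2M; last by ring.
clearbody E1 E2.
rewrite -mulrA normrM (normrM h) (ger0_norm (ltW h0)) ger0_norm // in B1.
rewrite normrM (ger0_norm (sqr_ge0 h)) in B2.
have X1 : h * (h * `|D1|) <= h * `|D1|.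
  by rewrite -[leRHS]mul1r ler_wpM2r // mulr_ge0 // ltW.
have X0 : h ^+ 2 * `|D0| <= `|D0| by rewrite ler_piMl // expr_le1 // ltW.
rewrite -g0E in X0 *.
rewrite !mulrDr expr2 -!mulrA in X0 B2 *.
by lra.
Qed.

End taylor.

Section observability.
Context (R : realType) (a b r rad : R).
Hypotheses (a_gt0 : 0 < a) (b_gt0 : 0 < b).
Hypothesis radP : absorbing_radius (lorenz a b r) rad.
Implicit Types (u v : 'rV[R]_3) (f g : 'rV[R]_3 -> R) (t h T : R).

Local Notation F := (lorenz a b r).
Local Notation obsD := (obsD a b r).

(** When [u 0 0 != 0], the 2-jet of the first coordinate is solved for the
    coordinates one after the other. *)
Lemma obsD_coercive u : u 0 0 != 0 ->
  exists2 C : R, 0 < C & forall v, cball rad v ->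
    enorm (v - u) <= C * (`|obsD 0 v - obsD 0 u| + `|obsD 1 v - obsD 1 u| +
                          `|obsD 2 v - obsD 2 u|).
Proof.
move=> u0; have m0 : 0 < `|u 0 0| by rewrite normr_gt0.
have [rad0 _] := radP.
pose c1 := a^-1 + 1; pose c2 := a^-1 + (1 + a) * c1 + rad.
have ai0 : 0 < a^-1 by rewrite invr_gt0.
have c10 : 0 < c1 by rewrite addr_gt0.
have c20 : 0 < c2 by rewrite !addr_gt0 ?mulr_gt0 // addr_gt0.
exists (1 + c1 + c2 / `|u 0 0|); first by rewrite !addr_gt0 // divr_gt0.
move=> v vB; have v2 := le_trans (normr_coord_le v 2) vB.
set D0 := obsD 0 v - _; set D1 := obsD 1 v - _; set D2 := obsD 2 v - _.
set S := `|D0| + `|D1| + `|D2|.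
have [S0 S1 S2] : [/\ `|D0| <= S, `|D1| <= S & `|D2| <= S].
  rewrite /S; split; first by rewrite -addrA lerDl addr_ge0.
    by rewrite addrAC lerDr addr_ge0.
  by rewrite lerDr addr_ge0.
set d0 := (v - u) 0 0; set d1 := (v - u) 0 1; set d2 := (v - u) 0 2.
have e0 : `|d0| <= S by rewrite /d0 coordB.
have e1 : `|d1| <= c1 * S.
  have -> : d1 = a^-1 * D1 + D0.
    by rewrite /d1 /D1 /D0 /= coordB; field; rewrite gt_eqF.
  rewrite mulrDl mul1r (le_trans (ler_normD _ _)) // lerD //.
  by rewrite normrM (gtr0_norm ai0) ler_pM2l.
have e2 : `|d2| <= c2 / `|u 0 0| * S.
  rewrite mulrAC ler_pdivlMr // -normrM.
  have -> : d2 * u 0 0 = - (a^-1 * D2) - (1 + a) * d1 - v 0 2 * d0.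
    by rewrite /d2 /d1 /d0 /D2 /= !coordB; field; rewrite gt_eqF.
  have a1 : 0 < 1 + a by rewrite addr_gt0.
  have -> : c2 * S = a^-1 * S + (1 + a) * (c1 * S) + rad * S.
    by rewrite /c2; ring.
  rewrite (le_trans (ler_normB _ _)) // lerD //.
    rewrite (le_trans (ler_normB _ _)) // normrN lerD //.
      by rewrite normrM (gtr0_norm ai0) ler_pM2l.
    by rewrite normrM (gtr0_norm a1) ler_pM2l.
  by rewrite normrM ler_pM.
apply: le_trans (enorm_le_sum _) _.
by rewrite 2!mulrDl mul1r !lerD.
Qed.

(** The bound is kept along with the Lipschitz constant, so that the property
    is closed under products. *)
Definition lipschitz_cball f := exists M L : R, forall u v,
  cball rad u -> cball rad v ->
  `|f u| <= M /\ `|f u - f v| <= L * enorm (u - v).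

Lemma lipschitz_cst (c : R) : lipschitz_cball (fun=> c).
Proof. by exists `|c|, 0 => u v _ _; rewrite subrr normr0 mul0r. Qed.

Lemma lipschitz_coord i : lipschitz_cball (fun v => v 0 i).
Proof.
exists rad, 1 => u v uB vB; rewrite mul1r -coordB.
by split; [exact: le_trans (normr_coord_le _ _) uB|exact: normr_coord_le].
Qed.

Lemma lipschitzD f g : lipschitz_cball f -> lipschitz_cball g ->
  lipschitz_cball (fun v => f v + g v).
Proof.
move=> [M [L fML]] [M' [L' gML]]; exists (M + M'), (L + L') => u v uB vB.
have [fM fL] := fML u v uB vB; have [gM gL] := gML u v uB vB.
split; first by rewrite (le_trans (ler_normD _ _)) // lerD.
rewrite (_ : _ - _ = (f u - f v) + (g u - g v)); last by ring.
by rewrite mulrDl (le_trans (ler_normD _ _)) // lerD.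
Qed.

Lemma lipschitzM f g : lipschitz_cball f -> lipschitz_cball g ->
  lipschitz_cball (fun v => f v * g v).
Proof.
move=> [M [L fML]] [M' [L' gML]].
exists (M * M'), (M * L' + L * M') => u v uB vB.
have [fM fL] := fML u v uB vB; have [gM gL] := gML u v uB vB.
have [gvM _] := gML v u vB uB.
split; first by rewrite normrM ler_pM.
rewrite (_ : _ - _ = f u * (g u - g v) + (f u - f v) * g v); last by ring.
rewrite [leRHS]mulrDl (le_trans (ler_normD _ _)) // lerD // normrM.
  by rewrite -mulrA ler_pM.
by rewrite mulrAC ler_pM.
Qed.

Lemma lipschitz_obsD3 : lipschitz_cball (obsD 3).
Proof.
have E v : obsD 3 v = - a * ((1 + a) * (- a * v 0 0 + -1 * v 0 1 +
    -1 * (v 0 0 * v 0 2)) + (a * (v 0 1 + -1 * v 0 0)) * v 0 2 +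
    v 0 0 * (- b * v 0 2 + v 0 0 * v 0 1 + - b * (r + a))).
  by rewrite /= !lorenzE; ring.
have [M [L H]] : lipschitz_cball (fun v => - a * ((1 + a) *
    (- a * v 0 0 + -1 * v 0 1 +
    -1 * (v 0 0 * v 0 2)) + (a * (v 0 1 + -1 * v 0 0)) * v 0 2 +
    v 0 0 * (- b * v 0 2 + v 0 0 * v 0 1 + - b * (r + a)))).
  repeat first [apply: lipschitz_cst | apply: lipschitz_coord
               | apply: lipschitzD | apply: lipschitzM].
by exists M, L => u v; rewrite !E; exact: H.
Qed.

Definition sampling_gap (Psi : R -> 'rV[R]_3 -> 'rV[R]_3) (h : R) (k : nat) v u
    : R :=
  \sum_(i < k) `|Psi (obs_time h i) v 0 0 - Psi (obs_time h i) u 0 0|.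

(** The jet is recovered from the samples up to an error [O(h * enorm (v - u))],
    because the Taylor remainder of a difference of two observed trajectories
    is itself Lipschitz in the initial point; for small [h] this error is
    absorbed into the left-hand side. *)
Lemma observability Psi u : is_flow F Psi -> cball rad u -> u 0 0 != 0 ->
  exists2 h0 : R, 0 < h0 & forall h, 0 < h < h0 ->
  exists2 C : R, 0 <= C & forall v, cball rad v ->
    enorm (v - u) <= C * sampling_gap Psi h 3 v u.
Proof.
move=> flowPsi uB u0; have [rad0 _] := radP.
have [Psi0 _ _] := flowPsi.
have [C C0 coercive] := obsD_coercive u0.
have [M0 [L0 lip]] := lipschitz_obsD3.
pose L := `|L0| * expR rad + 1.
have L_gt0 : 0 < L by rewrite ltr_wpDl // mulr_ge0 // expR_ge0.
have lipL v t : cball rad v -> 0 <= t <= 1 ->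
    `|obsD 3 (Psi t v) - obsD 3 (Psi t u)| <= L * enorm (v - u).
  move=> vB /andP[t0 t1].
  have sv := flow_solves v flowPsi; have su := flow_solves u flowPsi.
  have vtB : cball rad (Psi t v).
    by apply: (cball_invariant a_gt0 b_gt0 radP sv); rewrite ?Psi0.
  have utB : cball rad (Psi t u).
    by apply: (cball_invariant a_gt0 b_gt0 radP su); rewrite ?Psi0.
  have [_ /le_trans] := lip _ _ vtB utB; apply.
  have := solves_stable a_gt0 b_gt0 radP sv su.
  rewrite !Psi0 => /(_ vB t t0) st.
  apply: (@le_trans _ _ (`|L0| * (expR rad * enorm (v - u)))); last first.
    by rewrite mulrA ler_wpM2r ?enorm_ge0 // lerDl.
  apply: (@le_trans _ _ (`|L0| * enorm (Psi t v - Psi t u))).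
    by rewrite ler_wpM2r ?enorm_ge0 // ler_norm.
  rewrite ler_wpM2l // (le_trans st) // ler_wpM2r ?enorm_ge0 // ler_expR.
  by rewrite ler_piMr // ltW.
(* The first bound keeps [2 * h] in the unit interval where [lipL] holds; the
   second makes the remainder in the final estimate at most half of its
   left-hand side. *)
pose h0 := Num.min (1 / 2) (1 / (32 * (C * L))).
have CL0 : 0 < C * L by rewrite mulr_gt0.
exists h0; first by rewrite lt_min !divr_gt0 ?mulr_gt0.
move=> h /andP[h_gt0]; rewrite lt_min => /andP[h1 h2].
rewrite ltr_pdivlMr ?mulr_gt0 // in h2.
exists (10 * C / h ^+ 2); first by rewrite divr_ge0 ?mulr_ge0 ?sqr_ge0 // ltW.
move=> v vB; rewrite mulrAC ler_pdivlMr ?exprn_gt0 //.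
set N := enorm (v - u); have N0 : 0 <= N by exact: enorm_ge0.
pose g i t := obsD i (Psi t v) - obsD i (Psi t u).
have dg i t : (i < 3)%N -> 0 <= t -> is_derive t 1 (g i) (g i.+1 t).
  move=> i3 t0; have dv := is_derive_obsD i3 (flow_solves v flowPsi t0).
  have du := is_derive_obsD i3 (flow_solves u flowPsi t0).
  by rewrite /g; derive_poly.
have gE i t : g i t = obsD i (Psi t v) - obsD i (Psi t u) by [].
clearbody g.
have tay T : 0 <= T <= 1 ->
    `|g 0 T - g 0 0 - T * g 1 0 - T ^+ 2 / 2 * g 2 0| <= L * N * T ^+ 3.
  move=> /andP[T0 T1]; apply: (@taylor2 _ (g 0) (g 1) (g 2) (g 3)) => //.
  - by move=> t; apply: dg.
  - by move=> t; apply: dg.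
  - by move=> t; apply: dg.
  - move=> t /andP[t0 tT]; rewrite gE; apply: lipL => //.
    by rewrite t0 (le_trans tT).
have gap : sampling_gap Psi h 3 v u = `|g 0 0| + `|g 0 h| + `|g 0 (2 * h)|.
  by rewrite /sampling_gap /obs_time big_ord3 !gE /= mul0r mul1r.
rewrite gap.
have := @jet_le_values _ (g 0 0) (g 0 h) (g 0 (2 * h)) (g 0 0) (g 1 0)
  (g 2 0) h (L * N) _ erefl (tay h _) (tay (2 * h) _).
have -> : 0 < h <= 1 by lra.
have -> : 0 <= h <= 1 by lra.
have -> : 0 <= 2 * h <= 1 by lra.
move=> /(_ isT isT isT).
have := coercive v vB; rewrite -/N.
set G := _ + _ + `|g 0 (2 * h)|.
have -> : `|obsD 0 v - obsD 0 u| + `|obsD 1 v - obsD 1 u| +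
  `|obsD 2 v - obsD 2 u| = `|g 0 0| + `|g 1 0| + `|g 2 0| by rewrite !gE !Psi0.
set S := _ + _ + _ => NS hS.
have P1 : N * h ^+ 2 <= C * (h ^+ 2 * S).
  rewrite (_ : C * (h ^+ 2 * S) = C * S * h ^+ 2); last by ring.
  by rewrite ler_wpM2r ?sqr_ge0.
have P2 : C * (h ^+ 2 * S) <= C * (5 * G + 16 * (L * N) * h ^+ 3).
  by rewrite ler_pM2l.
have P3 : h * (32 * (C * L)) * (N * h ^+ 2) <= 1 * (N * h ^+ 2).
  by rewrite ler_wpM2r ?mulr_ge0 ?sqr_ge0 // ltW.
have E : C * (5 * G + 16 * (L * N) * h ^+ 3) =
  5 * (C * G) + h * (32 * (C * L)) * (N * h ^+ 2) / 2 by field.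
by rewrite E in P2; lra.
Qed.

End observability.

(** * Exceptional initial points *)

Section null_sets.
Context (R : realType).
Implicit Types u v : 'rV[R]_3.

Lemma measurable_coord n (i : 'I_n) :
  measurable_fun setT (fun v : 'rV[R]_n => v 0 i : measurableTypeR R).
Proof. by move: i; apply/measurable_fun_rVP; exact: measurable_id. Qed.

Lemma measurable_enorm d (T : measurableType d) (f : T -> 'rV[R]_3) :
  measurable_fun setT f -> measurable_fun setT (fun x => enorm (f x)).
Proof.
move=> /measurable_fun_rVP mf.
have msqrt : measurable_fun setT (@Num.sqrt R).
  by apply: continuous_measurable_fun; exact: sqrt_continuous.
apply: (measurableT_comp msqrt).
rewrite (_ : (fun x => dot (f x) (f x)) = (fun x => f x 0 0 * f x 0 0 +
  f x 0 1 * f x 0 1 + f x 0 2 * f x 0 2)).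
  2: by apply/funext => x; rewrite dotE.
by apply: measurable_funD; [apply: measurable_funD|];
  apply: measurable_funM; exact: mf.
Qed.

Lemma measurable_level (f : 'rV[R]_3 -> R) (c : R) :
  measurable_fun setT f -> measurable [set v | f v = c].
Proof.
move=> mf; rewrite (_ : [set v | f v = c] = f @^-1` [set c]) //.
by rewrite -[X in measurable X]setTI; apply: mf.
Qed.

Lemma product_measure_null d1 d2
    (T1 : measurableType d1) (T2 : measurableType d2)
    (m1 : {measure set T1 -> \bar R})
    (m2 : {sigma_finite_measure set T2 -> \bar R})
    (A : set (T1 * T2)) :
  (forall x, m2 (xsection A x) = 0%E) -> (m1 \x m2)%E A = 0%E.
Proof.
by move=> A0; rewrite /product_measure1; apply: integral0_eq => x _; exact: A0.
Qed.

Lemma lebesgue3_coord0 : @lebesgue3 R [set v | v 0 0 = 0] = 0%E.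
Proof.
rewrite /lebesgue3 /= /pushforward.
rewrite (_ : _ @^-1` _ = ([set 0] `*` setT) `*` setT); last first.
  apply/seteqP; split => [[[x y] z]|[[x y] z]] /=; rewrite !mxE /=.
    by move=> ->.
  by case=> -[-> _] _.
rewrite product_measure1E //; last exact: measurableX.
by rewrite /= product_measure1E //= lebesgue_measure_set1 !mul0e.
Qed.

(** Vertical lines meet a sphere in at most two points. *)
Lemma lebesgue3_sphere (c : R) : @lebesgue3 R [set v | enorm v = c] = 0%E.
Proof.
rewrite /lebesgue3 /= /pushforward.
set S := _ @^-1` _.
rewrite product_measure_null // => -[x y].
suff /finite_set_countable : finite_set (xsection S (x, y)).
  by move/countable_lebesgue_measure0.
pose w := Num.sqrt (c ^+ 2 - x ^+ 2 - y ^+ 2).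
apply: (@sub_finite_set _ _ [set w; - w]); last exact: finite_set2.
move=> z; rewrite /xsection /= inE /S /= => zc.
have : dot (row3 (x, y, z)) (row3 (x, y, z)) = c ^+ 2 by rewrite -zc sqr_enorm.
rewrite dotE !mxE /= => E.
have wz : w = `|z|.
  by rewrite /w -sqrtr_sqr; congr Num.sqrt; rewrite -E; ring.
rewrite wz; case: (ger0P z) => _; first by left.
by right; rewrite opprK.
Qed.

Lemma ae_generic (c : R) :
  {ae @lebesgue3 R, forall u, u 0 0 != 0 /\ enorm u != c}.
Proof.
have N1 : (@lebesgue3 R).-negligible [set v | v 0 0 = 0].
  exists [set v : 'rV[R]_3 | v 0 0 = 0]; split; last exact: subset_refl.
    by apply: measurable_level; exact: measurable_coord.
  exact: lebesgue3_coord0.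
have N2 : (@lebesgue3 R).-negligible [set v | enorm v = c].
  exists [set v : 'rV[R]_3 | enorm v = c]; split; last exact: subset_refl.
    by apply: measurable_level; apply: measurable_enorm; exact: measurable_id.
  exact: lebesgue3_sphere.
apply: negligibleS (negligibleU N1 N2) => u /= /not_andP[|] /negP.
  by rewrite negbK => /eqP ?; left.
by rewrite negbK => /eqP ?; right.
Qed.

End null_sets.

Section identifiability.
Context (R : realType) (a b r rad : R) (Psi : R -> 'rV[R]_3 -> 'rV[R]_3).
Hypotheses (a_gt0 : 0 < a) (b_gt0 : 0 < b).
Hypothesis flowPsi : is_flow (lorenz a b r) Psi.
Hypothesis radP : absorbing_radius (lorenz a b r) rad.
Implicit Types u v : 'rV[R]_3.

Lemma timeD_identifies j u : (2 <= j)%N -> cball rad u -> u 0 0 != 0 ->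
  [set v | cball rad v /\ forall i : nat, (i <= j)%N ->
     obs (timeD Psi i u) = obs (timeD Psi i v)] = [set u].
Proof.
move=> j2 uB u0; apply/seteqP; split => [v /= [vB E]|v /= -> //].
have [C _ /(_ v vB)] := obsD_coercive a_gt0 radP u0.
have D0 i : (i < 3)%N -> obsD a b r i v - obsD a b r i u = 0.
  move=> i3; rewrite -!(obs_timeD _ flowPsi) // E ?subrr //.
  by apply: leq_trans j2; rewrite -ltnS.
by rewrite !D0 // normr0 !addr0 mulr0; exact: enormB_le0.
Qed.

Lemma gradient_obs_timeD i u : (i < 3)%N ->
  gradient (fun v => obs (timeD Psi i v) 0 0) u =
  \row_(m < 3) nth 0 (nth [::] [:: [:: 1; 0; 0]; [:: - a; a; 0];
    [:: - a * u 0 2; - a * (1 + a); - a * u 0 0]] i) m.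
Proof.
move=> i3; rewrite (_ : (fun v => _) = obsD a b r i); last first.
  by apply/funext => v; rewrite (obs_timeD _ flowPsi).
apply/rowP => m; rewrite !mxE.
have dx := is_derive_id u (delta_mx 0 m : 'rV[R]_3).
have d0 := is_derive_coord 0 dx; have d1 := is_derive_coord 1 dx.
have d2 := is_derive_coord 2 dx.
apply: derive_val.
by case: i i3 => [|[|[|//]]] _ /=; derive_poly; move: {dx d0 d1 d2} m;
  apply: ord3P; rewrite !mxE /=; ring.
Qed.

Lemma span_gradients j u : (2 <= j)%N -> u 0 0 != 0 ->
  <<[seq gradient (fun v => obs (timeD Psi i v) 0%R l) u
       | i <- iota 0 j.+1, l <- enum 'I_3]>>%VS = {: 'rV[R]_3}%VS.
Proof.
move=> j2 u0; apply/eqP; rewrite eqEsubv subvf andTb; apply/subvP => x _.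
set grads := [seq _ | _ <- _, _ <- _].
have gs i : (i < 3)%N ->
    gradient (fun v => obs (timeD Psi i v) 0 0) u \in <<grads>>%VS.
  move=> i3; apply: memv_span; apply/allpairsP; exists (i, 0).
  split; [|exact: mem_enum|by []].
  by rewrite mem_iota add0n; apply: (leq_trans i3); rewrite ltnS.
pose c2 := - (x 0 2 / (a * u 0 0)).
pose c1 := x 0 1 / a + (1 + a) * c2.
pose c0 := x 0 0 + a * c1 + a * u 0 2 * c2.
rewrite (_ : x = c0 *: gradient (fun v => obs (timeD Psi 0 v) 0 0) u +
  c1 *: gradient (fun v => obs (timeD Psi 1 v) 0 0) u +
  c2 *: gradient (fun v => obs (timeD Psi 2 v) 0 0) u).
  by rewrite !rpredD // rpredZ // gs.
rewrite !gradient_obs_timeD //.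
by apply: rV3P; rewrite !mxE /= /c0 /c1 /c2; field; rewrite ?u0 ?gt_eqF.
Qed.

End identifiability.

(** * Bounded observation errors *)

Section supports.
Context (R : realType) (a b r rad : R) (Psi : R -> 'rV[R]_3 -> 'rV[R]_3).
Hypotheses (a_gt0 : 0 < a) (b_gt0 : 0 < b).
Hypothesis flowPsi : is_flow (lorenz a b r) Psi.
Hypothesis radP : absorbing_radius (lorenz a b r) rad.
Implicit Types (u v : 'rV[R]_3) (h t : R) (Y : nat -> 'rV[R]_3).

Lemma obs_time_ge0 h i : 0 <= h -> 0 <= obs_time h i.
Proof. by move=> h0; rewrite mulr_ge0. Qed.

Lemma flow_stable u v t : cball rad v -> 0 <= t ->
  enorm (Psi t v - Psi t u) <= expR (rad * t) * enorm (v - u).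
Proof.
have [Psi0 _ _] := flowPsi; move=> vB t0.
have := solves_stable a_gt0 b_gt0 radP (flow_solves v flowPsi)
  (flow_solves u flowPsi); rewrite !Psi0; exact.
Qed.

Lemma flow_rewind h i k v : 0 <= h -> (i <= k)%N -> cball rad v ->
  Psi (obs_time h i - obs_time h k) (Psi (obs_time h k) v) =
  Psi (obs_time h i) v.
Proof.
move=> h0 ik vB; have [_ _ PsiK] := flowPsi.
have d0 : 0 <= obs_time h k - obs_time h i.
  by rewrite subr_ge0 ler_wpM2r // ler_nat.
rewrite -[in Psi (obs_time h k) v](subrK (obs_time h i) (obs_time h k)).
rewrite (flow_semigroup a_gt0 b_gt0 radP flowPsi vB (obs_time_ge0 i h0) d0).
by rewrite -opprB PsiK.
Qed.

Lemma diameter_le (S : set 'rV[R]_3) u (c : R) :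
  (forall v, S v -> enorm (v - u) <= c) -> (diameter S <= (c + c)%:E)%E.
Proof.
move=> Sc; apply: ge_ereal_sup => _ [[v w] [/= Sv Sw] <-].
rewrite lee_fin (le_trans (ler_enormB _ _ u)) // lerD //; exact: Sc.
Qed.

Section likelihood.
Variables (q eta : 'rV[R]_3 -> R) (h : R) (k : nat) (Y : nat -> 'rV[R]_3).
Variable m : 'rV[R]_3 -> R.
Hypothesis h_ge0 : 0 <= h.

Let likely v := cball rad v /\
  forall i, (i <= k)%N -> eta (Y i - obs (Psi (obs_time h i) v)) != 0.

Lemma smoother_supp v :
  is_smoother Psi rad q eta h k Y m -> supp m v -> likely v.
Proof.
move=> [c c0 mE]; rewrite /supp /= mE mulf_eq0 negb_or => /andP[_].
rewrite /smoother_weight; case: ifPn; last by rewrite eqxx.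
rewrite inE => vB; rewrite mulf_eq0 negb_or => /andP[_ /prodf_neq0 P].
by split=> // i ik; have := P (Ordinal (ik : (i < k.+1)%N)) isT.
Qed.

Lemma filter_supp v : is_filter Psi rad q eta h k Y m -> supp m v ->
  exists2 v0, likely v0 & v = Psi (obs_time h k) v0.
Proof.
move=> [c c0 mE]; rewrite /supp /= mE mulf_eq0 negb_or => /andP[_].
rewrite /filter_weight; case: ifPn; last by rewrite eqxx.
rewrite inE => -[v0 v0B <-]; rewrite !mulf_eq0 !negb_or.
move=> /andP[/andP[/prodf_neq0 P _] _].
exists v0 => //; split=> // i ik.
have := P (Ordinal (ik : (i < k.+1)%N)) isT.
by rewrite flow_rewind.
Qed.

Lemma likely_gap u v (Z : nat -> 'rV[R]_3) (eps : R) : (2 <= k)%N ->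
  (forall i, Y i = obs (Psi (obs_time h i) u) + Z i) ->
  (forall i, (i < 3)%N -> enorm (Z i) <= eps) ->
  (forall z, eps < enorm z -> eta z = 0) ->
  likely v -> sampling_gap Psi h 3 v u <= 6 * eps.
Proof.
move=> k2 YE Zeps etaeps [vB lik].
have G i : (i < 3)%N ->
    `|Psi (obs_time h i) v 0 0 - Psi (obs_time h i) u 0 0| <= 2 * eps.
  move=> i3; have ik : (i <= k)%N by apply: leq_trans k2; rewrite -ltnS.
  have : enorm (Y i - obs (Psi (obs_time h i) v)) <= eps.
    by rewrite leNgt; apply: contra (lik i ik) => /etaeps ->.
  move=> /(le_trans (normr_coord_le _ 0)).
  have := le_trans (normr_coord_le (Z i) 0) (Zeps i i3).
  rewrite YE coordB coordD !obsE eqxx !ler_norml.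
  by move=> /andP[? ?] /andP[? ?]; apply/andP; split; lra.
have := G 0 isT; have := G 1 isT; have := G 2 isT.
by rewrite /sampling_gap big_ord3; lra.
Qed.

End likelihood.

End supports.

(** * Measurable near-minimisers *)

Section near_minimiser.
Context d (T : measurableType d) (R : realType).
Variables (cost : nat -> T -> R) (target : nat -> R).
Hypothesis cost_ge0 : forall n y, 0 <= cost n y.

Definition best_cost y : R := infs (cost ^~ y) 0.

(** The value [-oo] removes an index from the supremum taken below. *)
Definition near_min_targets (m n : nat) y : \bar R :=
  if cost n y <= best_cost y + m.+1%:R^-1 then (target n)%:E else -oo%E.

(** A substitute for the target of a minimiser, which need not exist: the upper
    limit of the targets of near-minimisers. Countable suprema and infima make
    it measurable without any selection of an index. *)
Definition near_min_target y : R :=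
  fine (einfs (fun m => esups (near_min_targets m ^~ y) 0) 0).

Let cost_lb y : has_lbound (range (cost ^~ y)).
Proof. by exists 0 => _ [n _ <-]. Qed.

Lemma best_cost_le n y : best_cost y <= cost n y.
Proof.
apply: ge_inf; last by exists n.
by have [c Hc] := cost_lb y; exists c => _ [i _ <-]; apply: Hc; exists i.
Qed.

Lemma best_cost_approx y (e : R) : 0 < e ->
  exists n, cost n y < best_cost y + e.
Proof.
move=> e0; have [|_ [n _ <-] ?] := @inf_adherent _ (sdrop (cost ^~ y) 0) e e0.
  split; first by exists (cost 0 y), 0%N.
  by have [c Hc] := cost_lb y; exists c => _ [i _ <-]; apply: Hc; exists i.
by exists n.
Qed.

Lemma measurable_near_min_target : (forall n, measurable_fun setT (cost n)) ->
  measurable_fun setT near_min_target.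
Proof.
move=> mcost; apply: measurableT_comp => //.
apply: measurable_fun_einfs => m; apply: measurable_fun_esups => n.
apply: measurable_fun_ifT; [|exact: measurable_cst|exact: measurable_cst].
apply: measurable_fun_ler => //.
apply: measurable_funD; last exact: measurable_cst.
by apply: measurable_fun_infs.
Qed.

(** [rho] bounds the infimum of the cost. A near-minimiser therefore costs at
    most [rho], up to a tolerance which vanishes in the limit, and each of the
    two occurrences of [rho] in its distance to [x] contributes [C * rho]. *)
Lemma near_min_target_close y (x C rho : R) : 0 <= C ->
  (forall n, `|target n - x| <= C * (cost n y + rho)) ->
  (forall e, 0 < e -> exists n, cost n y < rho + e) ->
  `|near_min_target y - x| <= 2 * C * rho.
Proof.
move=> C0 close approx.
have I_le : best_cost y <= rho.
  by apply/ler_addgt0Pr => e /approx[n /ltW]; exact/le_trans/best_cost_le.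
have small_tolerance (e : R) : 0 < e -> exists m, C * m.+1%:R^-1 <= e.
  move=> e0; exists (Num.truncn (C / e)).
  rewrite ler_pdivrMr // mulrC -ler_pdivrMr // ltW //; exact: truncnS_gt.
have near m n : cost n y <= best_cost y + m.+1%:R^-1 ->
    `|target n - x| <= 2 * C * rho + C * m.+1%:R^-1.
  move=> cn; apply: le_trans (close n) _.
  rewrite (_ : 2 * C * rho + _ = C * (rho + m.+1%:R^-1 + rho)); last by ring.
  by rewrite ler_wpM2l // lerD2r (le_trans cn) // lerD2r.
pose S := einfs (fun m => esups (near_min_targets m ^~ y) 0) 0.
have ub (e : R) : 0 < e -> (S <= (x + 2 * C * rho + e)%:E)%E.
  move=> e0; have [m me] : exists m, C * m.+1%:R^-1 <= e.
    exact: small_tolerance.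
  apply: (le_trans (ereal_inf_lbound _)); first by exists m.
  apply: ge_ereal_sup => _ [n _ <-]; rewrite /near_min_targets.
  case: ifP => [cn|_]; last exact: leNye.
  have := near m n cn; rewrite lee_fin ler_norml => /andP[_ close_n].
  by rewrite -addrA -lerBlDl (le_trans close_n) // lerD2l.
have lb (e : R) : 0 < e -> ((x - 2 * C * rho - e)%:E <= S)%E.
  move=> e0; apply: le_ereal_inf_tmp => _ [m _ <-].
  have [m' me] : exists m', C * m'.+1%:R^-1 <= e.
    exact: small_tolerance.
  (* An index admissible for [m], and with a tolerance small enough for [e]. *)
  pose M := maxn m m'.
  have inv_le (i : nat) : (i <= M)%N -> M.+1%:R^-1 <= i.+1%:R^-1 :> R.
    by move=> iM; rewrite lef_pV2 ?posrE ?ltr0n // ler_nat.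
  have [n /ltW cn] : exists n, cost n y < best_cost y + M.+1%:R^-1.
    by apply: best_cost_approx; rewrite invr_gt0 ltr0n.
  apply: le_ereal_sup_tmp; exists (near_min_targets m n y); first by exists n.
  rewrite /near_min_targets ifT; last first.
    by rewrite (le_trans cn) // lerD2l inv_le // leq_maxl.
  have : `|target n - x| <= 2 * C * rho + C * m'.+1%:R^-1.
    by apply: near; rewrite (le_trans cn) // lerD2l inv_le // leq_maxr.
  rewrite lee_fin ler_norml => /andP[close_n _].
  by rewrite -addrA -opprD -lerBrDl (le_trans _ close_n) // lerN2 lerD2l.
have Sfin : S = (near_min_target y)%:E.
  rewrite /near_min_target -/S fineK //.
  have := ub 1 ltr01; have := lb 1 ltr01.
  by case: (S).
rewrite ler_distl; apply/andP; split; apply/ler_addgt0Pr => e e0.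
  by have := lb e e0; rewrite Sfin lee_fin; lra.
by have := ub e e0; rewrite Sfin lee_fin; lra.
Qed.

End near_minimiser.

(** * Estimators *)

Section dense_sequence.
Context (R : realType) (rad : R).
Hypothesis rad_ge0 : 0 <= rad.
Implicit Types u : 'rV[R]_3.

Definition rational_point (p : rat * rat * rat) : 'rV[R]_3 :=
  \row_(i < 3) [:: ratr p.1.1; ratr p.1.2; ratr p.2]`_i.

(** An enumeration of the rational points of the ball, with repetitions. *)
Definition cball_seq (n : nat) : 'rV[R]_3 :=
  if unpickle n is Some p then
    if enorm (rational_point p) <= rad then rational_point p else 0
  else 0.

Lemma cball_seq_cball n : cball rad (cball_seq n).
Proof.
by rewrite /cball /= /cball_seq; case: unpickle => [p|]; [case: ifP|];
  rewrite ?enorm0.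
Qed.

Lemma cball_seq_dense u (e : R) : enorm u < rad -> 0 < e ->
  exists n, enorm (cball_seq n - u) < e.
Proof.
move=> u_rad e0; pose t := Num.min e (rad - enorm u) / 3.
have t0 : 0 < t by rewrite divr_gt0 // lt_min e0 subr_gt0.
have te : 3 * t <= e by rewrite mulrC divfK // ge_min lexx.
have tr : 3 * t <= rad - enorm u by rewrite mulrC divfK // ge_min lexx orbT.
have approx i : exists q : rat, `|ratr q - u 0 i| < t.
  have [|q] := @rat_in_itvoo R (u 0 i - t) (u 0 i + t); first by lra.
  by rewrite in_itv /= -ltr_distl => ?; exists q.
have [q0 h0] := approx 0; have [q1 h1] := approx 1; have [q2 h2] := approx 2.
pose p := (q0, q1, q2).
have pu : enorm (rational_point p - u) < 3 * t.
  apply: le_lt_trans (enorm_le_sum _) _; rewrite !coordB !mxE /=; lra.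
exists (pickle p); rewrite /cball_seq pickleK ifT.
  exact: lt_le_trans te.
rewrite -(subrK u (rational_point p)) (le_trans (ler_enormD _ _)) //.
by rewrite -lerBrDr (le_trans (ltW pu)).
Qed.

End dense_sequence.

Section estimators.
Context (R : realType) (a b r rad : R) (Psi : R -> 'rV[R]_3 -> 'rV[R]_3).
Hypotheses (a_gt0 : 0 < a) (b_gt0 : 0 < b).
Hypothesis flowPsi : is_flow (lorenz a b r) Psi.
Hypothesis radP : absorbing_radius (lorenz a b r) rad.
Implicit Types (u v : 'rV[R]_3) (h t : R).

Let rad_gt0 : 0 < rad. Proof. by case: radP. Qed.

Definition misfit h (k n : nat) (Y : k.+1.-tuple 'rV[R]_3) : R :=
  \sum_(i < k.+1)
    `|tnth Y i 0 0 - Psi (obs_time h i) (cball_seq rad n) 0 0|.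

(** The candidates form a fixed sequence, so that the flow enters through
    constants only and measurability in the data is immediate. *)
Definition estimator t h k (Y : k.+1.-tuple 'rV[R]_3) : 'rV[R]_3 :=
  \row_(l < 3)
    near_min_target (@misfit h k) (fun n => Psi t (cball_seq rad n) 0 l) Y.

Lemma misfit_ge0 h k n Y : 0 <= @misfit h k n Y.
Proof. exact: sumr_ge0. Qed.

Lemma measurable_estimator t h k : measurable_fun setT (@estimator t h k).
Proof.
apply/measurable_fun_rVP => l.
under eq_fun do rewrite mxE.
apply: measurable_near_min_target; first exact: misfit_ge0.
move=> n; apply: measurable_sum => i; apply: measurableT_comp => //.
apply: measurable_funB; last exact: measurable_cst.
apply: (measurableT_comp (measurable_coord 0)); exact: measurable_tnth.
Qed.

Lemma sampling_gap_le h k v u : 0 <= h -> cball rad v ->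
  sampling_gap Psi h k v u <=
    k%:R * expR (rad * obs_time h k) * enorm (v - u).
Proof.
move=> h0 vB; rewrite /sampling_gap -mulrA mulr_natl -[leRHS]/(_ *+ k).
rewrite -[X in _ *+ X]card_ord -sumr_const ler_sum // => i _.
rewrite -coordB (le_trans (normr_coord_le _ _)) //.
have := flow_stable a_gt0 b_gt0 flowPsi radP u vB (obs_time_ge0 i h0).
move=> /le_trans; apply; rewrite ler_wpM2r ?enorm_ge0 // ler_expR.
by rewrite ler_pM2l // ler_wpM2r // ler_nat ltnW.
Qed.

Lemma sampling_gap_mono h k v u : (2 <= k)%N ->
  sampling_gap Psi h 3 v u <= sampling_gap Psi h k.+1 v u.
Proof.
move=> k2; rewrite /sampling_gap.
rewrite -!(big_mkord xpredT
  (fun i => `|Psi (obs_time h i) v 0 0 - Psi (obs_time h i) u 0 0|)).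
by rewrite (@big_cat_nat _ _ _ 3 0 k.+1) //= lerDl sumr_ge0.
Qed.

(** The estimator never sees the true point: a near-minimiser of the misfit
    fits the data about as well as [u] does, so its observations are close to
    those of [u], and observability at [u] applies. *)
Lemma estimator_error u t h k (C : R) (z : nat -> 'rV[R]_3) : (2 <= k)%N ->
  0 <= h -> 0 <= t -> 0 <= C -> enorm u < rad ->
  (forall v, cball rad v -> enorm (v - u) <= C * sampling_gap Psi h 3 v u) ->
  enorm (estimator t h [tuple obs (Psi (obs_time h i) u) + z i | i < k.+1]
         - Psi t u) <=
    6 * (expR (rad * t) * C) * \sum_(i < k.+1) `|z i 0 0|.
Proof.
move=> k2 h0 t0 C0 u_rad obsC.
set Y := [tuple _ | _ < _]; set rho := \sum_(_ < _) _.
have inB := cball_seq_cball (ltW rad_gt0).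
have stab := flow_stable a_gt0 b_gt0 flowPsi radP u.
have YE i : tnth Y i 0 0 = Psi (obs_time h i) u 0 0 + z i 0 0.
  by rewrite tnth_mktuple coordD obsE eqxx.
have gap_le n : sampling_gap Psi h k.+1 (cball_seq rad n) u <=
    misfit h n Y + rho.
  rewrite /sampling_gap /misfit /rho -big_split ler_sum // => i _.
  rewrite YE; set A := Psi _ u 0 0; set B := Psi _ _ 0 0.
  rewrite (_ : B - A = z i 0 0 - (A + z i 0 0 - B)); last by ring.
  by rewrite [leRHS]addrC ler_normB.
have misfit_le n : misfit h n Y <=
    rho + sampling_gap Psi h k.+1 (cball_seq rad n) u.
  rewrite /sampling_gap /misfit /rho -big_split ler_sum // => i _.
  rewrite YE; set A := Psi _ u 0 0; set B := Psi _ _ 0 0.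
  rewrite (_ : A + z i 0 0 - B = z i 0 0 - (B - A)); last by ring.
  exact: ler_normB.
have coord l : `|estimator t h Y 0 l - Psi t u 0 l| <=
    2 * (expR (rad * t) * C) * rho.
  rewrite mxE; apply: near_min_target_close => //; first exact: misfit_ge0.
  - by rewrite mulr_ge0 // expR_ge0.
  - move=> n; rewrite -coordB (le_trans (normr_coord_le _ _)) //.
    rewrite (le_trans (stab _ _ (inB n) t0)) // -mulrA ler_pM2l ?expR_gt0 //.
    rewrite (le_trans (obsC _ (inB n))) // ler_wpM2l //.
    by rewrite (le_trans (sampling_gap_mono _ _ _ k2)).
  - move=> e e0; pose K := k.+1%:R * expR (rad * obs_time h k.+1).
    have K0 : 0 < K by rewrite mulr_gt0 ?expR_gt0 // ltr0n.
    have [n ne] := cball_seq_dense u_rad (divr_gt0 e0 K0).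
    exists n; apply: le_lt_trans (misfit_le n) _; rewrite ltrD2l.
    apply: le_lt_trans (sampling_gap_le _ _ h0 (inB n)) _.
    by rewrite mulrC -ltr_pdivlMr.
apply: le_trans (enorm_le_sum _) _; rewrite !coordB.
have := coord 0; have := coord 1; have := coord 2; lra.
Qed.

(** The factor [2 ^+ n] is cruder than the [n] of Cauchy-Schwarz, but is all
    that is needed. *)
Lemma sqr_sum_le n (x : 'I_n -> R) :
  (\sum_(i < n) x i) ^+ 2 <= 2 ^+ n * \sum_(i < n) x i ^+ 2.
Proof.
elim: n x => [|n IH] x; first by rewrite !big_ord0 expr0n mulr0.
rewrite !big_ord_recr /=; set s := \sum_(i < n) _; set y := x _.
have := IH (fun i => x (widen_ord (leqnSn n) i)); rewrite -/s.
set Q := \sum_(i < n) _ => sQ.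
have p1 : 1 <= 2 ^+ n :> R by rewrite exprn_ege1 // ler1n.
have y2 : y ^+ 2 <= 2 ^+ n * y ^+ 2 by rewrite ler_peMl ?sqr_ge0.
have : 0 <= (s - y) ^+ 2 by exact: sqr_ge0.
by rewrite (exprS 2 n); lra.
Qed.

Lemma estimator_mean_square u t h k (C : R) : (2 <= k)%N ->
  0 <= h -> 0 <= t -> 0 <= C -> enorm u < rad ->
  (forall v, cball rad v -> enorm (v - u) <= C * sampling_gap Psi h 3 v u) ->
  exists D : R, forall (d : measure_display) (Omega : measurableType d)
    (P : probability Omega R) (Z : nat -> {RV P >-> 'rV[R]_3}) (sigma : R),
  (forall i : nat,
     ('E_P[fun w => (enorm (Z i w) ^+ 2)%R] = (sigma ^+ 2)%:E)%E) ->
  ('E_P[fun w => (enorm (estimator t h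
       [tuple observation Psi u h Z i w | i < k.+1] - Psi t u) ^+ 2)%R]
     <= (D * sigma ^+ 2)%:E)%E.
Proof.
move=> k2 h0 t0 C0 u_rad obsC.
pose K := (6 * (expR (rad * t) * C)) ^+ 2 * 2 ^+ k.+1.
have K0 : 0 <= K by rewrite mulr_ge0 ?sqr_ge0 // exprn_ge0.
exists (K * k.+1%:R) => d Omega P Z sigma sigmaE.
have mZ i : measurable_fun setT (fun w => Z i w) by exact: measurable_funPT.
have msq (f : Omega -> 'rV[R]_3) : measurable_fun setT f ->
    measurable_fun setT (fun w => (enorm (f w) ^+ 2)%:E).
  by move=> mf; apply/measurable_EFinP/measurable_funX/measurable_enorm.
have mY : measurable_fun setT
    (fun w => [tuple observation Psi u h Z i w | i < k.+1]).
  apply/measurable_fun_tnthP => i.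
  rewrite (_ : _ \o _ = fun w => observation Psi u h Z i w); last first.
    by apply/funext => w /=; rewrite tnth_mktuple.
  apply/measurable_fun_rVP => l; rewrite /observation.
  under eq_fun do rewrite coordD.
  apply: measurable_funD; first exact: measurable_cst.
  exact: (measurableT_comp (measurable_coord l) (mZ i)).
have mE := measurableT_comp (@measurable_estimator t h k) mY.
rewrite unlock.
apply: (@le_trans _ _ (\int[P]_w (K%:E *
    \sum_(i < k.+1) (enorm (Z i w) ^+ 2)%:E))%E).
  apply: ge0_le_integral => //.
  - by move=> w _; rewrite lee_fin sqr_ge0.
  - apply: msq; apply/measurable_fun_rVP => l.
    under eq_fun do rewrite coordB.
    apply: measurable_funB; last exact: measurable_cst.
    apply: (measurableT_comp (measurable_coord l)).
    exact: mE.
  - by apply: measurable_funeM; apply: emeasurable_sum => i; exact: msq.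
  - move=> w _; rewrite sumEFin -EFinM lee_fin.
    have := estimator_error (fun i => Z i w) k2 h0 t0 C0 u_rad obsC.
    move=> /(lerXn2r 2 (enorm_ge0 _ : _ \in Num.nneg)).
    set E := enorm _ ^+ 2 => Ele; apply: le_trans (Ele _) _.
      by rewrite nnegrE !mulr_ge0 ?expR_ge0 // sumr_ge0.
    rewrite exprMn /K -[leRHS]mulrA. rewrite ler_wpM2l ?sqr_ge0 //.
    apply: le_trans (sqr_sum_le _) _; rewrite ler_wpM2l ?exprn_ge0 //.
    rewrite ler_sum // => i _; apply: lerXn2r; rewrite ?nnegrE ?enorm_ge0 //.
    exact: normr_coord_le.
rewrite ge0_integralZl_EFin //; last 2 first.
  - by move=> w _; apply: sume_ge0 => i _; rewrite lee_fin sqr_ge0.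
  - by apply: emeasurable_sum => i; exact: msq.
rewrite ge0_integral_sum //; last 2 first.
  - by move=> i; exact: msq.
  - by move=> i w _; rewrite lee_fin sqr_ge0.
rewrite (eq_bigr (fun=> (sigma ^+ 2)%:E)); last first.
  by move=> i _; rewrite -(sigmaE i) unlock.
rewrite sumEFin -EFinM lee_fin big_const_ord iter_addr_0.
by rewrite -mulrA mulr_natl.
Qed.

End estimators.

(** * The theorem *)

Theorem proposition4p2 (R : realType) (a b r rad : R)
    (Psi : R -> 'rV[R]_3 -> 'rV[R]_3)
    (a_gt0 : 0 < a) (b_gt0 : 0 < b) (r_gt0 : 0 < r)
    (flowPsi : is_flow (lorenz a b r) Psi)
    (radP : absorbing_radius (lorenz a b r) rad) :
  [/\
    (* identifiability from the first j derivatives of the observation *)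
    forall j : nat, (2 <= j)%N ->
      {ae @lebesgue3 R, forall u : 'rV[R]_3, cball rad u ->
        [/\ enorm u < rad,
            [set v | cball rad v /\
               forall i : nat, (i <= j)%N ->
                 obs (timeD Psi i u) = obs (timeD Psi i v)] = [set u] &
            <<[seq gradient (fun v => obs (timeD Psi i v) 0%R l) u
                 | i <- iota 0 j.+1, l <- enum 'I_3]>>%VS
            = {: 'rV[R]_3}%VS]},
    (* bounded observation errors *)
    {ae @lebesgue3 R, forall u : 'rV[R]_3, cball rad u ->
      exists2 h0 : R, 0 < h0 &
      forall h : R, 0 < h < h0 -> forall k : nat, (2 <= k)%N ->
      exists Csm Cfi : R,
      forall (q : 'rV[R]_3 -> R),
        is_density q -> (forall v, ~ cball rad v -> q v = 0) ->
      forall (d : measure_display) (Omega : measurableType d)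
        (P : probability Omega R) (eta : 'rV[R]_3 -> R)
        (Z : nat -> {RV P >-> 'rV[R]_3}) (eps : R),
        iid_noise eta Z ->
        (forall i : nat, {ae P, forall w, enorm (Z i w) <= eps}) ->
        (forall z, eps < enorm z -> eta z = 0) ->
      {ae P, forall w,
        let Y := fun i => observation Psi u h Z i w in
        (forall m, is_smoother Psi rad q eta h k Y m ->
           (diameter (supp m) <= (Csm * eps)%:E)%E) /\
        (forall m, is_filter Psi rad q eta h k Y m ->
           (diameter (supp m) <= (Cfi * eps)%:E)%E)}} &
    (* square-integrable observation errors *)
    exists Usm Ufi : R -> forall k : nat, k.+1.-tuple 'rV[R]_3 -> 'rV[R]_3,
      (forall h k, measurable_fun setT (Usm h k) /\
                   measurable_fun setT (Ufi h k)) /\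
      {ae @lebesgue3 R, forall u : 'rV[R]_3, cball rad u ->
        exists2 h0 : R, 0 < h0 &
        forall h : R, 0 < h < h0 -> forall k : nat, (2 <= k)%N ->
        exists Dsm Dfi : R,
        forall (d : measure_display) (Omega : measurableType d)
          (P : probability Omega R) (eta : 'rV[R]_3 -> R)
          (Z : nat -> {RV P >-> 'rV[R]_3}) (sigma : R),
          iid_noise eta Z ->
          (forall i : nat,
             ('E_P[fun w => (enorm (Z i w) ^+ 2)%R] = (sigma ^+ 2)%:E)%E) ->
        let Y := fun w => [tuple observation Psi u h Z i w | i < k.+1] in
        ('E_P[fun w => (enorm (Usm h k (Y w) - u) ^+ 2)%R]
           <= (Dsm * sigma ^+ 2)%:E)%E /\
        ('E_P[fun w => (enorm (Ufi h k (Y w) - Psi (obs_time h k) u) ^+ 2)%R]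
           <= (Dfi * sigma ^+ 2)%:E)%E}].
Proof.
have [Psi0 _ _] := flowPsi.
have inner (u : 'rV[R]_3) : cball rad u -> enorm u != rad -> enorm u < rad.
  by rewrite /cball /= lt_neqAle => -> ->.
split.
- move=> j j2; apply: filterS _ (ae_generic rad) => u [u0 u_rad] uB; split.
  + exact: inner.
  + exact: (timeD_identifies a_gt0 flowPsi radP j2 uB u0).
  + exact: (span_gradients a_gt0 flowPsi j2 u0).
- apply: filterS _ (ae_generic rad) => u [u0 _] uB.
  have [h0 h0_gt0 obsC] := observability a_gt0 b_gt0 radP flowPsi uB u0.
  exists h0 => // h hh0 k k2; have [C C0 {}obsC] := obsC h hh0.
  have h_ge0 : 0 <= h by case/andP: hh0 => /ltW.
  pose K := expR (rad * obs_time h k).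
  exists (6 * C + 6 * C), (K * (6 * C) + K * (6 * C)).
  move=> q _ _ d Omega P eta Z eps _ Zeps etaeps.
  apply: filterS3 _ (Zeps 0%N) (Zeps 1%N) (Zeps 2%N) => w Z0 Z1 Z2.
  have Zw i : (i < 3)%N -> enorm (Z i w) <= eps by case: i => [|[|[|]]].
  have close v : cball rad v -> sampling_gap Psi h 3 v u <= 6 * eps ->
      enorm (v - u) <= 6 * C * eps.
    move=> vB gap; apply: le_trans (obsC v vB) _.
    by rewrite (mulrC 6) -mulrA ler_wpM2l.
  split=> m mP; rewrite mulrDl.
  + apply: (diameter_le (u := u)) => v /(smoother_supp mP) lv.
    apply: close; first by case: lv.
    exact: (likely_gap k2 (fun=> erefl) Zw etaeps lv).
  + apply: (diameter_le (u := Psi (obs_time h k) u)) => v.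
    move=> /(filter_supp a_gt0 b_gt0 flowPsi radP h_ge0 mP)[v0 lv ->].
    have vB : cball rad v0 by case: lv.
    have := flow_stable a_gt0 b_gt0 flowPsi radP u vB (obs_time_ge0 k h_ge0).
    move=> /le_trans; apply; rewrite -/K -mulrA ler_pM2l ?expR_gt0 //.
    by apply: close => //; exact: (likely_gap k2 (fun=> erefl) Zw etaeps lv).
- exists (fun h k => @estimator R rad Psi 0 h k),
    (fun h k => @estimator R rad Psi (obs_time h k) h k); split.
    by move=> h k; split; exact: measurable_estimator.
  apply: filterS _ (ae_generic rad) => u [u0 u_rad] uB.
  have [h0 h0_gt0 obsC] := observability a_gt0 b_gt0 radP flowPsi uB u0.
  exists h0 => // h hh0 k k2; have [C C0 {}obsC] := obsC h hh0.
  have h_ge0 : 0 <= h by case/andP: hh0 => /ltW.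
  have MS t (t0 : 0 <= t) := estimator_mean_square a_gt0 b_gt0 flowPsi radP
    k2 h_ge0 t0 C0 (inner u uB u_rad) obsC.
  have [Dsm smP] := MS 0 (lexx 0); rewrite Psi0 in smP.
  have [Dfi fiP] := MS (obs_time h k) (obs_time_ge0 k h_ge0).
  exists Dsm, Dfi => d Omega P eta Z sigma _ sigmaE; split.
    exact: smP.
  exact: fiP.
Qed.
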